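(* Let $T\subset\mathbb{R}$ be a time scale with $\sup T=\infty$, let $a\in T$ with $a>0$, and let $0<\delta\le\infty$. Let $f(t,x)\in\mathbb{R}^N$ be defined for $t\in T$ and $x\in\mathbb{R}^N$ with $|x|<\delta$, and satisfy the inequality $$|f(t,x)|\le K(t)|x|,$$ where $K(t)\ge 0$ and $$\int_a^\infty K(t)\,\Delta t<\infty .$$ Let $x_0\in\mathbb{R}^N$ be sufficiently small in the sense that $$|x_0|\,e_K(t,a)<\delta\quad\text{for all } t\in T,\ t\ge a .$$ Then for a solution $x(t)$ of the system $x^\Delta(t)=f(t,x(t))$ satisfying $x(a)=x_0$, the limit $$x_\infty=\lim_{t\to\infty}x(t)$$ exists, and $x_\infty\ne 0$ unless $x(t)\equiv 0$.
   Context: A time scale $T$ is a nonempty closed subset of $\mathbb{R}$; $\sigma(t)=\inf\{s\in T: s>t\}$ is the forward jump operator, $\mu(t)=\sigma(t)-t$ is the graininess, $x^\Delta$ is the delta (Hilger) derivative, and $\int\cdots\Delta s$ is the delta integral on $T$. Limits as $t\to\infty$ are taken along $t\in T$, and $|\cdot|$ is a norm on $\mathbb{R}^N$. The function $K:T\to[0,\infty)$ is rd-continuous (continuous at right-dense points of $T$, with finite left-sided limits at left-dense points), and $e_K(t,a)$ denotes the time-scale exponential function of $K$, i.e. the unique solution of the scalar initial value problem $y^\Delta=K(t)y$, $y(a)=1$. A solution $x(t)$ with $x(a)=x_0$ is a function defined for $t\in T$, $t\ge a$, with $|x(t)|<\delta$, which satisfies $x^\Delta(t)=f(t,x(t))$,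 and is represented in the form $x(t)=x(a)+\int_a^t f(s,x(s))\,\Delta s$.
   Formalization: The last clause is false as stated (T={1,2,…}, f(1,x)=-x, f=0 later). Proved instead: if x_∞=0, then x≡0 on t≥a, or some s≥a in T has x(s)≠0, K(s)μ(s)≥1 and x(t)=0 for all t>s. *)

(* Defs.v *)
From HB Require Import structures.
From mathcomp Require Import all_boot all_order all_algebra.
From mathcomp Require Import all_classical all_reals all_analysis.
Import Order.TTheory GRing.Theory Num.Theory.
Import numFieldNormedType.Exports.

Set Implicit Arguments.
Unset Strict Implicit.
Unset Printing Implicit Defensive.

Local Open Scope classical_set_scope.
Local Open Scope ring_scope.

Section TimeScale.
Context {R : realType}.
Implicit Types (T : set R) (t a b : R).

Definition time_scale T : Prop := T !=set0 /\ closed T.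

Definition unbounded_time_scale T : Prop :=
  time_scale T /\ ereal_sup [set t%:E | t in T] = +oo%E.

(* Only meaningful when T has points to the right of t, which is always the
   case when sup T = +oo; then also T^kappa = T, so that delta derivatives are
   considered at every point of T below. *)
Definition sigma T t : R := inf [set s | T s /\ t < s].

(* The guard in [left_dense] excludes t = min T, where the supremum is empty. *)
Definition rho T t : R := sup [set s | T s /\ s < t].

Definition mu T t : R := sigma T t - t.

Definition right_dense T t : Prop := T t /\ sigma T t = t.

Definition left_dense T t : Prop :=
  [/\ T t, [set s | T s /\ s < t] !=set0 & rho T t = t].

Definition rd_continuous T (g : R -> R) : Prop :=
  (forall t, right_dense T t -> g s @[s --> within T (nbhs t)] --> g t) /\
  (forall t, left_dense T t ->
     exists l : R, g s @[s --> within T (t^'-)] --> l).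

(* The filter of t -> +oo along T. *)
Definition at_infty T : set_system R := within T (pinfty_nbhs R).

(* The part of T from a on; it is again a time scale, with the same sigma. *)
Definition tail T a : set R := T `&` [set t | a <= t].

Section VectorValued.
Context {V : normedModType R}.
Implicit Types (x g F : R -> V).

Definition is_delta_derive T x t (l : V) : Prop :=
  forall eps : R, 0 < eps -> \forall s \near within T (nbhs t),
    `|x (sigma T t) - x s - (sigma T t - s) *: l| <= eps * `|sigma T t - s|.

Definition delta_antiderivative T F g : Prop :=
  forall t, T t -> is_delta_derive T F t (g t).

(* The Cauchy delta integral: the increment of an antiderivative on T. *)
Definition is_delta_integral T g a b (I : V) : Prop :=
  exists2 F, delta_antiderivative T F g & I = F b - F a.

Definition is_delta_integral_infty T g a (I : V) : Prop :=
  exists2 J : R -> V,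
    (forall t, T t -> a <= t -> is_delta_integral T g a t (J t)) &
    J t @[t --> at_infty T] --> I.

End VectorValued.

(* [is_delta_exp T K a e] says that e is e_K(., a) on T. *)
Definition is_delta_exp T (K : R -> R) a (e : R -> R) : Prop :=
  (forall t, T t -> is_delta_derive T e t (K t * e t)) /\ e a = 1.

Definition is_vector_norm (N : nat) (nrm : 'rV[R]_N -> R) : Prop :=
  [/\ forall u v, nrm (u + v) <= nrm u + nrm v,
      forall (c : R) u, nrm (c *: u) = `|c| * nrm u &
      forall u, nrm u = 0 -> u = 0].

(* A solution is only given on [a, +oo) in T, so its derivative and the
   integral are taken on the time scale [tail T a]; the values of the total
   function x outside it are irrelevant. *)
Definition is_solution (N : nat) T a (nrm : 'rV[R]_N -> R) (delta : \bar R)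
    (f : R -> 'rV[R]_N -> 'rV[R]_N) (x : R -> 'rV[R]_N) : Prop :=
  forall t, T t -> a <= t ->
    [/\ ((nrm (x t))%:E < delta)%E,
        is_delta_derive (tail T a) x t (f t (x t)) &
        exists2 I, is_delta_integral (tail T a) (fun s => f s (x s)) a t I
                 & x t = x a + I].

End TimeScale.

(* Main.v *)
Require Import Defs.
From HB Require Import structures.
From mathcomp Require Import all_boot all_order all_algebra.
From mathcomp Require Import all_classical all_reals all_analysis.
From mathcomp Require Import lra ring.
Import Order.TTheory GRing.Theory Num.Theory.
Import numFieldNormedType.Exports.
Local Open Scope classical_set_scope.
Local Open Scope ring_scope.

Set Implicit Arguments.
Unset Strict Implicit.
Unset Printing Implicit Defensive.

(** Why the theorem holds.  Since [K >= 0] has a finite integral over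
    [[a, +oo)], an antiderivative [F] of [K] is nondecreasing and bounded, so
    its increments beyond a suitable point [b] are as small as one likes.
    A mean value inequality on time scales turns [|x^Delta| <= K |x|] into
    [|x(t) - x(s)| <= M (F(t) - F(s))] wherever [|x| <= M] on [[s, t)]
    ([increment_le]).  Everything follows from applying this estimate on
    stretches where [F] increases by at most [1/2].

    - Forward from [b], it keeps the norm of [x] below [2 |x(b)| + 1]
      ([solution_bounded]).  With this bound for [M], the estimate is a Cauchy
      criterion, and [x] converges.
    - If [x] is bounded by [M] on [[b, +oo)] and tends to [0], then
      [|x(t)| = |x(t) - x(+oo)| <= M / 2] there: every bound can be halved,
      hence [x = 0] on [[b, +oo)] ([vanish_after]).
    - Let [u] be the infimum of the points of the time scale from which on [x]
      vanishes; by continuity [x(u) = 0].  If [u] is left-dense, the halving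
      argument on a short interval ending at [u] pushes the vanishing to the
      left of [u], a contradiction ([vanish_before]).  So either [u = a] and
      [x] is identically [0], or [u = sigma(r)] with [x(r) <> 0], and then
      [x(r) + mu(r) f(r, x(r)) = 0] forces [1 <= K(r) mu(r)]
      ([zero_tail_dichotomy]).

    The norm on [R^N] is arbitrary whereas derivatives and limits refer to the
    maximum norm, so the equivalence of the two norms is needed in both
    directions. *)

(** * Equivalence of norms on row vectors *)

Section VectorNorms.
Context {R : realType} {N : nat} {p : 'rV[R]_N -> R}.
Hypothesis pN : is_vector_norm p.

Lemma vnorm0 : p 0 = 0.
Proof. by case: pN => _ h _; rewrite -(scale0r 0) h normr0 mul0r. Qed.

Lemma vnormN u : p (- u) = p u.
Proof. by case: pN => _ h _; rewrite -scaleN1r h normrN1 mul1r. Qed.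

Lemma vnorm_ge0 u : 0 <= p u.
Proof.
case: (pN) => pD _ _; have := pD u (- u).
by rewrite subrr vnorm0 vnormN => h; lra.
Qed.

Lemma vnormB u v : p (u - v) = p (v - u).
Proof. by rewrite -vnormN opprB. Qed.

Lemma vnorm_sum_le (I : Type) (r : seq I) (g : I -> 'rV[R]_N) :
  p (\sum_(i <- r) g i) <= \sum_(i <- r) p (g i).
Proof.
elim/big_ind2 : _ => [|x u y v ux vy|//]; first by rewrite vnorm0.
by case: (pN) => pD _ _; apply: le_trans (pD u v) _; exact: lerD.
Qed.

Lemma vnorm_le_mx_norm : exists2 C, 0 < C & forall u, p u <= C * `|u|.
Proof.
exists (1 + \sum_(j < N) p (delta_mx 0 j)).
  by rewrite ltr_pwDl// sumr_ge0// => i _; exact: vnorm_ge0.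
move=> u; rewrite {1}(row_sum_delta u).
apply: le_trans (vnorm_sum_le _ _) _.
rewrite mulrDl mul1r -[leLHS]add0r lerD// mulr_suml ler_sum// => j _.
case: (pN) => _ pZ _; rewrite pZ mulrC ler_wpM2l ?vnorm_ge0//.
rewrite [leRHS]/Num.norm /= mx_normrE.
by apply/bigmax_geP; right => /=; exists (0, j).
Qed.

Lemma vnorm_continuous : continuous p.
Proof.
have [C C0 pC] := vnorm_le_mx_norm.
case: (pN) => pD _ _ u; apply/(@cvgrPdist_le _ _ _ (nbhs u) _ p (p u)) => e e0.
have : \forall v \near u, `|u - v| <= e / C.
  apply/nbhs_ballP; exists (e / C) => /=; first by rewrite divr_gt0.
  by move=> v; rewrite -ball_normE => /ltW.
apply: filterS => v uv.
have h1 : p u <= p (u - v) + p v by rewrite -{1}(subrK v u).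
have h2 : p v <= p (u - v) + p u by rewrite vnormB -{1}(subrK u v).
apply: (@le_trans _ _ (p (u - v))); first by rewrite ler_norml; lra.
by apply: le_trans (pC _) _; rewrite mulrC -ler_pdivlMr.
Qed.

(** By compactness, [p] attains its minimum on the unit sphere of the maximum
    norm, and that minimum is positive. *)
Lemma mx_norm_le_vnorm : exists2 C, 0 < C & forall u, `|u| <= C * p u.
Proof.
case: (pN) => pD pZ p_eq0.
pose S := [set u : 'rV[R]_N | `|u| = 1].
have norml (u : 'rV[R]_N) : u != 0 -> S (`|u|^-1 *: u).
  by move=> u0; rewrite /S /= normrZ ger0_norm ?invr_ge0// mulVf// normr_eq0.
(* For [N = 0] the sphere is empty and there is no minimum to take. *)
have [[u0 Su0]|S0] := pselect (S !=set0); last first.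
  exists 1 => // u; have [->|/norml Su] := eqVneq u 0.
    by rewrite normr0 vnorm0 mulr0.
  by case: S0; exists (`|u|^-1 *: u).
have cS : compact S.
  apply: bounded_closed_compact.
    by exists 1; split => // M M1 u /= ->; exact: ltW.
  have -> : S = (fun u : 'rV[R]_N => `|u|) @^-1` [set 1] by [].
  apply: closed_comp; last exact: closed_eq.
  by move=> u _; exact: norm_continuous.
have [||c /set_mem Sc cmin] := @EVT_min_rV R N p S _ cS.
- by exists u0.
- by apply: continuous_subspaceT => u; exact: vnorm_continuous.
have pc0 : 0 < p c.
  rewrite lt_neqAle vnorm_ge0 andbT; apply/eqP => /esym/p_eq0 c0.
  by move: Sc; rewrite /S /= c0 normr0 => /eqP; rewrite eq_sym oner_eq0.
exists (p c)^-1; rewrite ?invr_gt0// => u.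
have [->|nu] := eqVneq u 0; first by rewrite normr0 vnorm0 mulr0.
have /mem_set/cmin := norml _ nu; rewrite pZ ger0_norm ?invr_ge0// => h.
by rewrite ler_pdivlMl// mulrC -ler_pdivlMl ?normr_gt0.
Qed.

End VectorNorms.

(** * Points and induction on a time scale *)

Section TimeScales.
Context {R : realType} {T : set R}.
Hypothesis Tcl : closed T.
Implicit Types (P : R -> Prop) (b c r s t u : R).

Lemma closed_adherent u :
  (forall d, 0 < d -> exists2 s, T s & `|s - u| < d) -> T u.
Proof.
move=> h; apply: Tcl => B /nbhs_ballP[d /= d0 dB].
have [s Ts su] := h _ d0; exists s; split => //.
by apply: dB; rewrite /ball /= distrC.
Qed.

Lemma inf_in_scale (E : set R) : E `<=` T -> E !=set0 -> has_lbound E ->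
  T (inf E).
Proof.
move=> ET E0 Elb; apply: closed_adherent => d d0.
have [s Es sE] := inf_adherent d0 (conj E0 Elb).
exists s; first exact: ET.
by rewrite ger0_norm ?subr_ge0 ?ge_inf// ltrBlDl.
Qed.

Lemma sup_in_scale (E : set R) : E `<=` T -> E !=set0 -> has_ubound E ->
  T (sup E).
Proof.
move=> ET E0 Eub; apply: closed_adherent => d d0.
have [s Es sE] := sup_adherent d0 (conj E0 Eub).
exists s; first exact: ET.
by rewrite ler0_norm ?subr_le0 ?ub_le_sup// opprB ltrBlDl -ltrBlDr.
Qed.

Lemma sigma_ge t s : T s -> t < s -> sigma T t <= s.
Proof. by move=> Ts ts; apply: ge_inf => //; exists t => y [_ /ltW]. Qed.

Lemma sigma_ge_self t s : T s -> t < s -> t <= sigma T t.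
Proof. by move=> Ts ts; apply: lb_le_inf; [exists s|move=> y [_ /ltW]]. Qed.

Lemma sigma_eq t s : T s -> t < s -> (forall r, T r -> t < r -> s <= r) ->
  sigma T t = s.
Proof.
move=> Ts ts sP; apply/le_anti; rewrite sigma_ge//=.
by apply: lb_le_inf; [exists s|move=> y [Ty ty]; exact: sP].
Qed.

Lemma right_dense_adherent t c d : T c -> t < c -> sigma T t = t -> 0 < d ->
  exists s, [/\ T s, t < s & s < t + d].
Proof.
move=> Tc tc st d0.
have hi : has_inf [set s | T s /\ t < s].
  by split; [exists c|exists t => y [_ /ltW]].
have [s [Ts ts]] := inf_adherent d0 hi.
by rewrite -/(sigma T t) st => sd; exists s.
Qed.

(** The point to consider is [rho T t], which lies in [T] because [T] is closed:
    it is the [r] of the first case when it differs from [t]. *)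
Lemma left_scattered_or_dense b t : T b -> T t -> b < t ->
  (exists r, [/\ T r, b <= r, r < t & sigma T r = t]) \/
  (forall d, 0 < d -> exists s, [/\ T s, b <= s, s < t & t - s < d]).
Proof.
move=> Tb Tt bt; pose E := [set s | T s /\ s < t].
have E0 : E !=set0 by exists b.
have Eub : has_ubound E by exists t => s [_ /ltW].
have br : b <= sup E by apply: ub_le_sup.
have Tr : T (sup E) by apply: sup_in_scale => // s [].
have : sup E <= t by apply: ge_sup => // s [_ /ltW].
rewrite le_eqVlt => /predU1P[rt|rt].
  (* The bound [b <= s] is obtained by asking for [s] within [t - b] of [t],
     unless [b] itself is close enough. *)
  right => d d0; case: (leP (t - b) (d / 2)) => bd.
    by exists b; split => //; lra.
  have h : 0 < Num.min d (t - b) by rewrite lt_min d0 subr_gt0.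
  have [s [Ts st]] := sup_adherent h (conj E0 Eub).
  rewrite rt ltrBlDl -ltrBlDr lt_min => /andP[sd sb].
  by exists s; split => //; lra.
left; exists (sup E); split => //; apply: sigma_eq => // s Ts.
by case: (leP t s) => // st; rewrite ltNge ub_le_sup.
Qed.

(** If [P] failed somewhere, the infimum [u] of the points where it fails would
    be in [T]; the first hypothesis gives [P u], and the second contradicts
    the choice of [u].  The first hypothesis is a strong induction step, so it
    serves left-dense points and jumps alike, and the second is trivial
    at right-scattered points, where a small interval to the right of [u]
    contains no point of [T]. *)
Lemma scale_induction b P : T b ->
  (forall u, T u -> b <= u -> (forall s, T s -> b <= s -> s < u -> P s) ->
     P u) ->
  (forall u, T u -> b <= u -> (forall s, T s -> b <= s -> s <= u -> P s) ->
     exists2 d, 0 < d & forall s, T s -> u < s -> s < u + d -> P s) ->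
  forall t, T t -> b <= t -> P t.
Proof.
move=> Tb Pstep Pnear t Tt bt; apply: contrapT => nPt.
pose E := [set s | [/\ T s, b <= s & ~ P s]].
have E0 : E !=set0 by exists t.
have Elb : has_lbound E by exists b => s [].
have Tu : T (inf E) by apply: inf_in_scale => // s [].
have bu : b <= inf E by apply: lb_le_inf => // s [].
have Plt s : T s -> b <= s -> s < inf E -> P s.
  move=> Ts bs su; apply: contrapT => nPs.
  by move: su; rewrite ltNge ge_inf.
have Pu := Pstep _ Tu bu Plt.
have [|d d0 Pd] := Pnear _ Tu bu.
  by move=> s Ts bs; rewrite le_eqVlt => /predU1P[->//|]; exact: Plt.
have [s [Ts bs nPs] sd] := inf_adherent d0 (conj E0 Elb).
apply: nPs; case: (ltgtP s (inf E)) => [||->//]; first exact: Plt.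
by move=> us; exact: Pd.
Qed.

End TimeScales.

(** * Delta derivatives and the mean value inequality *)

Section DeltaDerivative.
Context {R : realType} {T : set R} {V : normedModType R}.
Implicit Types (X : R -> V) (t s : R) (l : V).

Lemma delta_derive_near X t l eps : is_delta_derive T X t l -> 0 < eps ->
  exists2 d, 0 < d & forall s, T s -> `|s - t| < d ->
    `|X (sigma T t) - X s - (sigma T t - s) *: l| <= eps * `|sigma T t - s|.
Proof.
move=> dX e0; have /nbhs_ballP[d /= d0 dP] := dX _ e0.
exists d => // s Ts sd; apply: dP => //.
by rewrite /ball /= distrC.
Qed.

(** The point [s = t] is itself admitted in the definition of the derivative,
    where the error [eps * mu] is arbitrarily small. *)
Lemma delta_derive_jump X t l : T t -> is_delta_derive T X t l ->
  X (sigma T t) - X t = (sigma T t - t) *: l.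
Proof.
move=> Tt dX; apply/eqP; rewrite -subr_eq0 -normr_le0; apply/ler_addgt0Pl.
move=> e e0; rewrite addr0; pose k := `|sigma T t - t| + 1.
have k0 : 0 < k by rewrite ltr_wpDl.
have [d d0 /(_ t Tt)] := delta_derive_near dX (divr_gt0 e0 k0).
rewrite subrr normr0 => /(_ d0) h; apply: le_trans h _.
by rewrite mulrAC ler_pdivrMr// ler_pM2l// lerDl.
Qed.

(** By the exact formula across the jump, the increment from [sigma T t] can be
    replaced by the increment from [t]; this form gives continuity at [t], and
    the usual differentiability when [t] is right-dense. *)
Lemma delta_derive_increment X t l eps : T t -> is_delta_derive T X t l ->
  0 < eps -> exists2 d, 0 < d & forall s, T s -> `|s - t| < d ->
    `|X t - X s - (t - s) *: l| <= eps * `|sigma T t - s|.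
Proof.
move=> Tt dX e0; have [d d0 dP] := delta_derive_near dX e0.
exists d => // s Ts sd; apply: le_trans (dP _ Ts sd).
suff -> : X t - X s - (t - s) *: l =
  X (sigma T t) - X s - (sigma T t - s) *: l by [].
have /eqP := delta_derive_jump Tt dX; rewrite subr_eq => /eqP ->.
rewrite -(subrKA t (sigma T t) (- s)) (scalerDl l (sigma T t - t)).
by rewrite opprD -[_ + X t - X s]addrA [in RHS]addrACA subrr add0r.
Qed.

Lemma delta_derive_continuous X t l eps : T t -> is_delta_derive T X t l ->
  0 < eps -> exists2 d, 0 < d & forall s, T s -> `|s - t| < d ->
    `|X s - X t| <= eps.
Proof.
move=> Tt dX e0; pose m := `|sigma T t - t| + 1.
have m0 : 0 < m by rewrite ltr_wpDl.
have [d d0 dP] := delta_derive_increment Tt dX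
  (divr_gt0 (divr_gt0 e0 (ltr0Sn R 1)) m0).
pose k := `|l| + 1; have k0 : 0 < k by rewrite ltr_wpDl.
exists (Num.min d (Num.min 1 (eps / 2 / k))).
  by rewrite !lt_min d0 ltr01 !divr_gt0.
move=> s Ts; rewrite !lt_min => /and3P[sd s1 sk].
rewrite distrC -[X t - X s](subrK ((t - s) *: l)).
apply: le_trans (ler_normD _ _) _; rewrite [leRHS](splitr eps) lerD//.
  apply: le_trans (dP _ Ts sd) _.
  rewrite mulrAC ler_pdivrMr// ler_pM2l ?divr_gt0//.
  rewrite -(subrKA t (sigma T t) (- s)).
  by apply: le_trans (ler_normD _ _) _; rewrite lerD// distrC ltW.
rewrite normrZ distrC; move: sk; rewrite ltr_pdivlMr// => /ltW; apply: le_trans.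
by rewrite ler_wpM2l// /k lerDl.
Qed.

End DeltaDerivative.

Section MeanValueInequality.
Context {R : realType} {T : set R} {V : normedModType R}.
Context {p : V -> R} {C : R}.
Hypothesis Tcl : closed T.
Hypothesis pD : forall u v, p (u + v) <= p u + p v.
Hypothesis pZ : forall (c : R) u, p (c *: u) = `|c| * p u.
Hypothesis C0 : 0 <= C.
Hypothesis pC : forall u, p u <= C * `|u|.
Implicit Types (X : R -> V) (G : R -> R) (b c r s t u : R).

(** Induction along [T] proves the inequality with an extra slope [e'], which
    absorbs the error of the derivative at right-dense points.  Jumps are
    exact, and left-dense points follow by continuity. *)
Lemma mean_value_inequality X X' G G' b c : T b -> T c -> b <= c ->
  (forall t, T t -> b <= t -> t <= c -> is_delta_derive T X t (X' t)) ->
  (forall t, T t -> b <= t -> t <= c -> is_delta_derive T G t (G' t)) ->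
  (forall t, T t -> b <= t -> t < c -> p (X' t) <= G' t) ->
  p (X c - X b) <= G c - G b.
Proof.
move=> Tb Tc bc dX dG XG.
have ptri x y z : p (x - z) <= p (x - y) + p (y - z).
  by rewrite -(subrKA y x (- z)); exact: pD.
apply/ler_addgt0Pl => e e0.
(* The summand [1] only keeps the denominator positive when [b = c]. *)
pose e' := e / (c - b + 1).
have cb1 : 0 < c - b + 1 by lra.
have e'0 : 0 < e' by rewrite divr_gt0.
suff /(_ c Tc bc (lexx c)) : forall t, T t -> b <= t ->
    t <= c -> p (X t - X b) <= e' * (t - b) + (G t - G b).
  move=> /le_trans; apply; rewrite lerD2r /e' mulrAC ler_pdivrMr//.
  by rewrite ler_pM2l//; lra.
apply: (scale_induction Tcl Tb) => [u Tu bu IH uc|u Tu bu IH].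
  move: bu; rewrite le_eqVlt => /predU1P[->|bu].
    by rewrite !subrr mulr0 addr0 -(scale0r (0 : V)) pZ normr0 mul0r.
  have [[r [Tr br ru sr]]|ld] := left_scattered_or_dense Tcl Tb Tu bu.
    have rc : r < c := lt_le_trans ru uc.
    have := delta_derive_jump Tr (dX r Tr br (ltW rc)).
    have := delta_derive_jump Tr (dG r Tr br (ltW rc)).
    rewrite sr => jG jX; have := IH r Tr br ru (ltW rc).
    have := ptri (X u) (X r) (X b); rewrite jX pZ gtr0_norm ?subr_gt0//.
    have : (u - r) * p (X' r) <= (u - r) * G' r.
      by rewrite ler_pM2l ?subr_gt0// XG.
    have -> : (u - r) * G' r = G u - G r by rewrite jG.
    have : 0 <= e' * (u - r) by rewrite mulr_ge0 ?subr_ge0 ?ltW.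
    lra.
  apply/ler_addgt0Pl => h h0.
  have C1 : 0 < C + 1 by rewrite ltr_wpDl.
  have hC : 0 < h / 2 / (C + 1) by rewrite !divr_gt0.
  have h2 : 0 < h / 2 by rewrite divr_gt0.
  have [d1 d10 X1] := delta_derive_continuous Tu (dX u Tu (ltW bu) uc) hC.
  have [d2 d20 G2] := delta_derive_continuous Tu (dG u Tu (ltW bu) uc) h2.
  have [|s [Ts bs su sd]] := ld (Num.min d1 d2); first by rewrite lt_min d10.
  move: sd; rewrite lt_min => /andP[sd1 sd2].
  have us : `|s - u| = u - s by rewrite distrC gtr0_norm ?subr_gt0.
  have := IH s Ts bs su (le_trans (ltW su) uc).
  have := ptri (X u) (X s) (X b).
  have := G2 s Ts; rewrite us => /(_ sd2); rewrite ler_norml => /andP[_ G2s].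
  have : p (X u - X s) <= h / 2.
    apply: le_trans (pC _) _; rewrite distrC.
    have := X1 s Ts; rewrite us => /(_ sd1); rewrite ler_pdivlMr// => ?.
    by apply: le_trans _ (_ : `|X s - X u| * (C + 1) <= _); rewrite ?mulrDr//;
      have := normr_ge0 (X s - X u); lra.
  have : 0 <= e' * (u - s) by rewrite mulr_ge0 ?subr_ge0 ?ltW.
  lra.
case: (leP c u) => [cu|uc].
  by exists 1 => // s Ts us _ sc; lra.
have [dense|scattered] := pselect (sigma T u = u); last first.
  exists (sigma T u - u).
    have := sigma_ge_self Tc uc; rewrite le_eqVlt => /predU1P[/esym//|].
    by rewrite subr_gt0.
  by move=> s Ts us; rewrite subrKC ltNge (sigma_ge Ts us).
have C1 : 0 < C + 1 by rewrite ltr_wpDl.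
have C2 : 0 < e' / (C + 1) by rewrite divr_gt0.
have [d1 d10 X1] := delta_derive_increment Tu (dX u Tu bu (ltW uc)) C2.
have [d2 d20 G2] := delta_derive_increment Tu (dG u Tu bu (ltW uc)) C2.
exists (Num.min d1 d2); first by rewrite lt_min d10.
move=> s Ts us; rewrite -ltrBlDl lt_min => /andP[sd1 sd2] sc.
have su : `|s - u| = s - u by rewrite gtr0_norm ?subr_gt0.
have us' : `|sigma T u - s| = s - u by rewrite dense distrC su.
have := IH u Tu bu (lexx u) (ltW uc).
have := ptri (X s) (X u) (X b).
have := G2 s Ts; rewrite su us' => /(_ sd2); rewrite ler_norml => /andP[_ +].
have {X1} := X1 s Ts; rewrite su us' => /(_ sd1) X1.
have : p (X s - X u) <= (s - u) * p (X' u) + C * (e' / (C + 1) * (s - u)).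
  rewrite -[X s - X u](subrK ((s - u) *: X' u)) addrC.
  apply: le_trans (pD _ _) _; rewrite pZ gtr0_norm ?subr_gt0// lerD2l.
  apply: le_trans (pC _) _; rewrite ler_wpM2l//; apply: le_trans X1.
  rewrite -normrN; suff -> : - (X s - X u - (s - u) *: X' u) =
    X u - X s - (u - s) *: X' u by [].
  by rewrite opprB opprB -[u - s]opprB scaleNr opprK addrC.
have : (s - u) * p (X' u) <= (s - u) * G' u.
  by rewrite ler_pM2l ?subr_gt0// XG.
rewrite /GRing.scale /=.
have -> : C * (e' / (C + 1) * (s - u)) = e' * (s - u) - e' / (C + 1) * (s - u).
  by field; rewrite gt_eqF.
lra.
Qed.

End MeanValueInequality.

(** * Linearly bounded systems with slowly growing antiderivative *)

Lemma delta_derive_scale (R : realType) (T : set R) (F : R -> R) (t k c : R) :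
  is_delta_derive T F t k -> is_delta_derive T (fun s => c * F s) t (c * k).
Proof.
move=> dF e e0; have k0 : 0 < `|c| + 1 by rewrite ltr_wpDl.
have := dF _ (divr_gt0 e0 k0); apply: filterS => s h.
have -> : c * F (sigma T t) - c * F s - (sigma T t - s) *: (c * k) =
  c * (F (sigma T t) - F s - (sigma T t - s) *: k).
  by rewrite /GRing.scale /=; ring.
rewrite normrM; apply: le_trans (_ : (`|c| + 1) * (e / (`|c| + 1) *
  `|sigma T t - s|) <= _).
  by apply: ler_pM => //; rewrite lerDl.
by rewrite mulrA (mulrC _ (e / _)) divfK ?gt_eqF.
Qed.

(** The mean value inequality applies to two antiderivatives of the same
    nonnegative function.  The case [F = G] is what makes antiderivatives
    monotone. *)
Lemma antiderivative_increment_le (R : realType) (T : set R)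
    (F G K : R -> R) b c : closed T ->
  (forall t, T t -> is_delta_derive T F t (K t)) ->
  (forall t, T t -> is_delta_derive T G t (K t)) ->
  (forall t, T t -> 0 <= K t) -> T b -> T c -> b <= c ->
  `|F c - F b| <= G c - G b.
Proof.
move=> Tcl dF dG K0 Tb Tc bc.
apply: (@mean_value_inequality R T R^o (fun u => `|u|) 1 Tcl _ _ _ _
  F K G K b c Tb Tc bc) => //.
- by move=> u v; exact: ler_normD.
- by move=> k u; exact: normrM.
- by move=> u; rewrite mul1r.
- by move=> t Tt _ _; exact: dF.
- by move=> t Tt _ _; exact: dG.
- by move=> t Tt _ _; rewrite ger0_norm// K0.
Qed.

Lemma antiderivative_nondecreasing (R : realType) (T : set R)
    (F K : R -> R) b c : closed T ->
  (forall t, T t -> is_delta_derive T F t (K t)) ->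
  (forall t, T t -> 0 <= K t) -> T b -> T c -> b <= c -> F b <= F c.
Proof.
move=> Tcl dF K0 Tb Tc bc; rewrite -subr_ge0.
by apply: le_trans (antiderivative_increment_le Tcl dF dF K0 Tb Tc bc).
Qed.

(** The supremum [m] of [phi] satisfies [0 <= m <= m / 2]. *)
Lemma halving_bound_eq0 (R : realType) (E : set R) (phi : R -> R) M :
  (forall t, E t -> 0 <= phi t) -> (forall t, E t -> phi t <= M) ->
  (forall m, (forall t, E t -> phi t <= m) ->
     forall t, E t -> phi t <= m / 2) ->
  forall t, E t -> phi t = 0.
Proof.
move=> phi0 phiM half t Et; pose m := sup (phi @` E).
have phi_m s : E s -> phi s <= m.
  move=> Es; apply: ub_le_sup; last by exists s.
  by exists M => _ [r Er <-]; exact: phiM.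
have : m <= m / 2.
  by apply: ge_sup; [exists (phi t); exists t|move=> _ [s Es <-]; exact: half].
by have := phi_m t Et; have := phi0 t Et; lra.
Qed.

Section Solutions.
Context {R : realType} {N : nat} {p : 'rV[R]_N -> R} {T : set R}.
Context {x x' : R -> 'rV[R]_N} {F K : R -> R}.
Hypothesis pN : is_vector_norm p.
Hypothesis Tcl : closed T.
Hypothesis dx : forall t, T t -> is_delta_derive T x t (x' t).
Hypothesis dF : forall t, T t -> is_delta_derive T F t (K t).
Hypothesis K0 : forall t, T t -> 0 <= K t.
Hypothesis x'K : forall t, T t -> p (x' t) <= K t * p (x t).
Implicit Types (b c s t u M : R).

Let F_le b c : T b -> T c -> b <= c -> F b <= F c.
Proof. exact: (antiderivative_nondecreasing Tcl dF K0). Qed.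

Let ptri v w : p v <= p (v - w) + p w.
Proof. by rewrite -{1}(subrK w v); case: pN. Qed.

(** This is the mean value inequality for the comparison function [M * F]. *)
Lemma increment_le b c M : T b -> T c -> b <= c ->
  (forall t, T t -> b <= t -> t < c -> p (x t) <= M) ->
  p (x c - x b) <= M * (F c - F b).
Proof.
move=> Tb Tc bc xM; have [C C0 pC] := vnorm_le_mx_norm pN.
case: (pN) => pD pZ _; rewrite mulrBr.
apply: (@mean_value_inequality R T _ p C Tcl pD pZ (ltW C0) pC
  x x' (fun t => M * F t) (fun t => M * K t)) => //.
- by move=> t Tt _ _; exact: dx.
- by move=> t Tt _ _; exact/delta_derive_scale/dF.
- move=> t Tt bt tc; apply: le_trans (x'K Tt) _.
  by rewrite mulrC ler_wpM2r ?K0// xM.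
Qed.

(** As long as the bound [M := 2 p (x b) + 1] holds, the increment from [b] is
    at most [M / 2], so [p (x t) <= p (x b) + M / 2 = M - 1 / 2]: the bound
    holds with room to spare, and continuity carries it to the right. *)
Lemma solution_bounded b c : T b -> T c -> b <= c -> F c - F b <= 1 / 2 ->
  forall t, T t -> b <= t -> t <= c -> p (x t) <= 2 * p (x b) + 1.
Proof.
move=> Tb Tc bc Fbc; pose M := 2 * p (x b) + 1; rewrite -/M.
have M0 : 0 <= M by rewrite addr_ge0// mulr_ge0// vnorm_ge0.
have slack u : T u -> b <= u -> u <= c ->
    (forall s, T s -> b <= s -> s < u -> p (x s) <= M) ->
    p (x u) <= M - 1 / 2.
  move=> Tu bu uc xM; have := increment_le Tb Tu bu xM.
  have : M * (F u - F b) <= M * (1 / 2).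
    by apply: ler_wpM2l => //; have := F_le Tu Tc uc; lra.
  by have := ptri (x u) (x b); rewrite /M; lra.
apply: (scale_induction Tcl Tb) => [u Tu bu IH uc|u Tu bu IH].
  suff : p (x u) <= M - 1 / 2 by lra.
  by apply: slack => // s Ts bs su; apply: IH => //; lra.
have [C C0 pC] := vnorm_le_mx_norm pN.
have e0 : 0 < 1 / 2 / C by rewrite !divr_gt0.
have [d d0 dP] := delta_derive_continuous Tu (dx Tu) e0.
exists d => // s Ts us sd sc.
have xu : p (x u) <= M - 1 / 2.
  by apply: slack => //; [lra|move=> r Tr br ru; apply: IH => //; lra].
have : p (x s - x u) <= 1 / 2.
  apply: le_trans (pC _) _; rewrite mulrC -ler_pdivlMr//; apply: dP => //.
  by rewrite gtr0_norm; lra.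
by have := ptri (x s) (x u); lra.
Qed.

(** Since [x c = 0], a bound [m] on [[b, c]] improves to [m / 2] by comparing
    each value with [x c]. *)
Lemma vanish_before b c : T b -> T c -> b <= c -> F c - F b <= 1 / 2 ->
  x c = 0 -> forall t, T t -> b <= t -> t <= c -> x t = 0.
Proof.
move=> Tb Tc bc Fbc xc0 t Tt bt tc; case: (pN) => _ _; apply.
apply: (@halving_bound_eq0 R [set t | [/\ T t, b <= t & t <= c]]
  (fun t => p (x t)) (2 * p (x b) + 1)) => //.
- by move=> s _; exact: vnorm_ge0.
- by move=> s [Ts bs sc]; exact: solution_bounded Fbc _ _ _ _.
- move=> m xm s [Ts bs sc].
  have m0 : 0 <= m by apply: le_trans (xm c _); [exact: vnorm_ge0|split].
  have -> : p (x s) = p (x c - x s) by rewrite xc0 sub0r vnormN.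
  apply: le_trans (increment_le (M := m) Ts Tc sc _) _.
    by move=> r Tr sr rc; apply: xm; split => //; lra.
  apply: ler_wpM2l => //.
  by have := F_le Tb Ts bs; lra.
Qed.

(** The same halving with the limit [0] at infinity in place of [x c]. It is
    enough that [x] comes arbitrarily close to [0] arbitrarily late. *)
Lemma vanish_after b : T b ->
  (forall t, T t -> b <= t -> F t - F b <= 1 / 2) ->
  (forall e, 0 < e -> forall t, T t ->
     exists s, [/\ T s, t <= s & p (x s) <= e]) ->
  forall t, T t -> b <= t -> x t = 0.
Proof.
move=> Tb Fb x0 t Tt bt; case: (pN) => _ _; apply.
apply: (@halving_bound_eq0 R [set t | T t /\ b <= t]
  (fun t => p (x t)) (2 * p (x b) + 1)) => //.
- by move=> s _; exact: vnorm_ge0.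
- by move=> s [Ts bs]; exact: (solution_bounded Tb Ts bs (Fb _ Ts bs)).
- move=> m xm s [Ts bs].
  have m0 : 0 <= m by apply: le_trans (xm b _); [exact: vnorm_ge0|split].
  apply/ler_addgt0Pl => e e0; have [r [Tr sr xr]] := x0 _ e0 _ Ts.
  have := ptri (x s) (x r); rewrite (vnormB pN).
  have : p (x r - x s) <= m * (F r - F s).
    apply: increment_le => // q Tq sq qr; apply: xm; split => //.
    exact: le_trans sq.
  have : m * (F r - F s) <= m * (1 / 2).
    apply: ler_wpM2l => //.
    by have := Fb r Tr (le_trans bs sr); have := F_le Tb Ts bs; lra.
  lra.
Qed.

Lemma jump_to_zero r : T r -> x r <> 0 -> x (sigma T r) = 0 ->
  r <= sigma T r -> 1 <= K r * mu T r.
Proof.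
move=> Tr xr0 xs0 rs; case: (pN) => _ pZ p_eq0.
have pr0 : 0 < p (x r).
  by rewrite lt_neqAle (vnorm_ge0 pN) andbT; apply/eqP => /esym/p_eq0.
have := delta_derive_jump Tr (dx Tr); rewrite xs0 sub0r => /(congr1 p).
rewrite vnormN// pZ ger0_norm ?subr_ge0// -/(mu T r) => h.
have : p (x r) <= mu T r * (K r * p (x r)).
  by rewrite {1}h; apply: ler_wpM2l; [rewrite subr_ge0|exact: x'K].
by rewrite mulrCA mulrA -ler_pdivrMr// divff ?gt_eqF.
Qed.

(** Going back in time, a solution can stay away from [0] before vanishing only
    by jumping onto [0]. *)
Lemma zero_tail_dichotomy a b : T a -> (forall t, T t -> a <= t) ->
  T b -> (forall t, T t -> b <= t -> x t = 0) ->
  (forall t, T t -> x t = 0) \/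
  (exists r, [/\ T r, x r <> 0, 1 <= K r * mu T r &
                 forall t, T t -> r < t -> x t = 0]).
Proof.
move=> Ta aT Tb xb.
pose Z := [set s | T s /\ forall t, T t -> s <= t -> x t = 0].
have Z0 : Z !=set0 by exists b.
have Zlb : has_lbound Z by exists a => s [/aT].
pose u := inf Z.
have Tu : T u by apply: inf_in_scale => // s [].
have Zadh d : 0 < d -> exists2 z, Z z & z < u + d.
  by move=> d0; exact: inf_adherent.
have Zu : Z u.
  apply: contrapT => nZu.
  have gt_u s : T s -> u < s -> x s = 0.
    move=> Ts us; have [|z [_ xz] zs] := Zadh (s - u).
      by rewrite subr_gt0.
    by apply: xz => //; lra.
  apply: nZu; split => // t Tt.
  rewrite le_eqVlt => /predU1P[<-|]; last exact: gt_u.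
  have [//|xu] := pselect (x u = 0).
  apply/eqP; rewrite -normr_le0; apply/ler_addgt0Pl => e e0; rewrite addr0.
  have [d d0 dP] := delta_derive_continuous Tu (dx Tu) e0.
  have [z [Tz xz] zd] := Zadh _ d0.
  have uz : u <= z by apply: ge_inf.
  have := dP z Tz; rewrite xz// sub0r normrN; apply.
  by rewrite ger0_norm; lra.
have := aT _ Tu; rewrite le_eqVlt => /predU1P[au|au].
  by left => t Tt; apply: Zu.2 => //; rewrite -au; exact: aT.
have notZ s : s < u -> ~ Z s by move=> su Zs; move: su; rewrite ltNge ge_inf.
have xu0 : x u = 0 by apply: Zu.2.
right; have [[r [Tr _ ru sr]]|ld] := left_scattered_or_dense Tcl Ta Tu au.
  have xr0 : x r <> 0.
    move=> xr; apply: (notZ r ru); split => // t Tt.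
    rewrite le_eqVlt => /predU1P[<-//|rt]; apply: Zu.2 => //.
    by rewrite -sr sigma_ge.
  exists r; split => //; first by apply: jump_to_zero; rewrite ?sr// ltW.
  by move=> t Tt rt; apply: Zu.2 => //; rewrite -sr sigma_ge.
have h0 : 0 < 1 / 2 :> R by rewrite divr_gt0.
have [d d0 dP] := delta_derive_continuous Tu (dF Tu) h0.
have [s [Ts _ su sd]] := ld _ d0.
exfalso; apply: (notZ s su); split => // t Tt st.
case: (leP t u) => [tu|/ltW]; last exact: Zu.2.
apply: (vanish_before Ts Tu (ltW su) _ xu0) => //.
have := dP s Ts; rewrite distrC gtr0_norm ?subr_gt0// => /(_ sd).
by rewrite ler_norml => /andP[]; lra.
Qed.

End Solutions.

(** * The tail of a time scale and the filter at infinity *)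

Section Tail.
Context {R : realType} {T : set R}.
Implicit Types (a b t s M : R) (P : R -> Prop).

Lemma closed_tail a : closed T -> closed (tail T a).
Proof. by move=> Tcl; apply: closedI => //; exact: closed_ge. Qed.

Lemma sigma_tail a t : a <= t -> sigma (tail T a) t = sigma T t.
Proof.
move=> at_; rewrite /sigma; congr inf; apply/seteqP; split=> s /=.
  by move=> [[Ts _] ts].
by move=> [Ts ts]; split => //; split => //=; exact: le_trans (ltW ts).
Qed.

Lemma delta_derive_tail (V : normedModType R) (X : R -> V) a t l : a <= t ->
  is_delta_derive T X t l -> is_delta_derive (tail T a) X t l.
Proof.
move=> at_ dX e e0; rewrite sigma_tail//; have := dX _ e0.
by rewrite !near_withinE; apply: filterS => s h [Ts _]; exact: h.
Qed.

Lemma unbounded_scale_gt M : unbounded_time_scale T -> exists2 t, T t & M < t.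
Proof.
move=> [_ Tsup]; apply: contrapT => nT.
suff : (ereal_sup [set t%:E | t in T] <= M%:E)%E by rewrite Tsup.
apply: ge_ereal_sup => _ [t Tt <-]; rewrite lee_fin leNgt.
by apply/negP => Mt; apply: nT; exists t.
Qed.

Lemma near_at_inftyP P :
  (\forall t \near at_infty T, P t) <->
  exists M, forall t, T t -> M < t -> P t.
Proof.
split; first by move=> [M [_ MP]]; exists M => t Tt Mt; exact: MP.
by move=> [M MP]; exists M; split => [|t Mt Tt]; [exact: num_real|exact: MP].
Qed.

Lemma at_infty_proper : unbounded_time_scale T -> ProperFilter (at_infty T).
Proof.
move=> Tub; apply: Build_ProperFilter_ex => P /near_at_inftyP[M MP].
by have [t Tt Mt] := unbounded_scale_gt M Tub; exists t; exact: MP.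
Qed.

End Tail.

(** * Integrability of the bound and the limit of solutions *)

Lemma bounded_nondecreasing_flat_tail (R : realType) (E : set R)
    (F : R -> R) (B e : R) : E !=set0 ->
  (forall t, E t -> F t <= B) -> 0 < e ->
  (forall s t, E s -> E t -> s <= t -> F s <= F t) ->
  exists2 b, E b & forall t, E t -> b <= t -> F t - F b <= e.
Proof.
move=> [t0 Et0] FB e0 Fmono.
have hs : has_sup (F @` E).
  by split; [exists (F t0); exists t0|exists B => _ [t Et <-]; exact: FB].
have [_ [b Eb <-] Fb] := sup_adherent e0 hs.
exists b => // t Et bt.
have : F t <= sup (F @` E) by apply: ub_le_sup; [case: hs|exists t].
by lra.
Qed.

(** The integrals [J t] may a priori come from a different antiderivative for
    each [t]; [antiderivative_increment_le] compares them all with a single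
    [F], which is therefore bounded and hence nearly constant far out. *)
Lemma delta_integrable_flat_tail (R : realType) (T : set R) (K : R -> R)
    a I : unbounded_time_scale T -> T a -> (forall t, T t -> 0 <= K t) ->
  is_delta_integral_infty T K a I ->
  exists2 F, delta_antiderivative T F K & forall e, 0 < e ->
    exists2 b, tail T a b & forall t, T t -> b <= t -> F t - F b <= e.
Proof.
move=> Tub Ta K0 [J hJ JI]; have [[_ Tcl] _] := Tub.
have [F dF _] := hJ a Ta (lexx a); exists F => // e e0.
have FJ t : T t -> a <= t -> F t - F a <= J t.
  move=> Tt at_; have [G dG ->] := hJ t Tt at_.
  by have := antiderivative_increment_le Tcl dF dG K0 Ta Tt at_;
    rewrite ler_norml => /andP[].
have Fmono s t : T s -> T t -> s <= t -> F s <= F t.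
  exact: antiderivative_nondecreasing Tcl dF K0.
have TF := at_infty_proper Tub.
have /(cvgr_le _)/(_ (I + 1)) := JI; rewrite ltrDl => /(_ ltr01).
move=> /near_at_inftyP[M JM].
have FB t : tail T a t -> F t <= F a + (I + 1).
  move=> [Tt at_]; have [s Ts] := unbounded_scale_gt (Num.max M t) Tub.
  rewrite gt_max => /andP[Ms ts].
  have := JM s Ts Ms; have := Fmono t s Tt Ts (ltW ts).
  by have := FJ s Ts (le_trans at_ (ltW ts)); lra.
have [||b Sb Fb] := bounded_nondecreasing_flat_tail _ FB e0 _.
- by exists a; split => //=; exact: lexx.
- by move=> s t [Ts _] [Tt _]; exact: Fmono.
exists b => // t Tt bt; apply: Fb => //; split => //=.
by case: Sb => _ ab; exact: le_trans bt.
Qed.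

Theorem theorem4 (R : realType) (N : nat) (nrm : 'rV[R]_N -> R)
    (T : set R) (a : R) (delta : \bar R)
    (f : R -> 'rV[R]_N -> 'rV[R]_N) (K e_K : R -> R)
    (x0 : 'rV[R]_N) (x : R -> 'rV[R]_N) :
  is_vector_norm nrm ->
  unbounded_time_scale T -> T a -> 0 < a -> (0 < delta)%E ->
  (forall t, T t -> 0 <= K t) ->
  rd_continuous T K ->
  (forall t u, T t -> ((nrm u)%:E < delta)%E -> nrm (f t u) <= K t * nrm u) ->
  (exists I : R, is_delta_integral_infty T K a I) ->
  is_delta_exp T K a e_K ->
  (forall t, T t -> a <= t -> ((nrm x0 * e_K t)%:E < delta)%E) ->
  is_solution T a nrm delta f x ->
  x a = x0 ->
  exists2 xoo : 'rV[R]_N,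
    x t @[t --> at_infty T] --> xoo &
    xoo = 0 ->
      (forall t, T t -> a <= t -> x t = 0) \/
      (exists s, [/\ T s, a <= s, x s <> 0, 1 <= K s * mu T s &
                     forall t, T t -> s < t -> x t = 0]).
Proof.
move=> nN Tub Ta _ _ K0 _ fK [I KI] _ _ sol _.
have [F dF Fflat] := delta_integrable_flat_tail Tub Ta K0 KI.
have [[_ Tcl] _] := Tub; have Scl := closed_tail (a := a) Tcl.
set S := tail T a in Scl Fflat.
have dx t : S t -> is_delta_derive S x t (f t (x t)).
  by move=> [Tt at_]; have [] := sol t Tt at_.
have dFS t : S t -> is_delta_derive S F t (K t).
  by move=> [Tt at_]; apply: delta_derive_tail => //; exact: dF.
have K0S t : S t -> 0 <= K t by move=> [/K0].
have xK t : S t -> nrm (f t (x t)) <= K t * nrm (x t).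
  by move=> [Tt at_]; apply: fK => //; have [] := sol t Tt at_.
have half0 : 0 < 1 / 2 :> R by rewrite divr_gt0.
have [b Sb Fb] := Fflat _ half0.
have [Tb ab] := Sb.
have Sge s t : S s -> T t -> s <= t -> S t.
  by move=> [_ as_] Tt st; split => //=; exact: le_trans st.
pose M := 2 * nrm (x b) + 1.
have M0 : 0 < M by rewrite ltr_wpDl// mulr_ge0// (vnorm_ge0 nN).
have xM t : T t -> b <= t -> nrm (x t) <= M.
  move=> Tt bt; have St := Sge b t Sb Tt bt.
  exact: (solution_bounded nN Scl dx dFS K0S xK Sb St bt (Fb t Tt bt)).
have TF := at_infty_proper Tub.
have [C C0 nC] := mx_norm_le_vnorm nN.
have xcvg : cvg (x t @[t --> at_infty T]).
  apply/cauchy_cvgP/cauchy_exP => e e0.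
  have e'0 : 0 < e / 2 / M / C by rewrite !divr_gt0.
  (* Beyond [c], the increments of [x] are at most [C * M] times those of [F];
     the factor [1 / 2] makes the final inequality strict. *)
  have [c Sc Fc] := Fflat _ e'0.
  pose d := Num.max b c.
  have Sd : S d by rewrite /d maxEle; case: ifP.
  exists (x d); apply/near_at_inftyP; exists d => t Tt /ltW dt.
  rewrite -ball_normE /= distrC; apply: le_lt_trans (nC _) _.
  have bd : b <= d by rewrite le_max lexx.
  have cd : c <= d by rewrite le_max lexx orbT.
  have : nrm (x t - x d) <= M * (F t - F d).
    apply: (increment_le nN Scl dx dFS K0S xK Sd (Sge _ _ Sd Tt dt) dt).
    by move=> s [Ts _] ds _; apply: xM => //; exact: le_trans ds.
  have Ftd : F t - F d <= e / 2 / M / C.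
    have := antiderivative_nondecreasing Scl dFS K0S Sc Sd cd.
    by have := Fc t Tt (le_trans cd dt); lra.
  move=> /le_trans/(_ (ler_wpM2l (ltW M0) Ftd)).
  move=> /(ler_wpM2l (ltW C0))/le_lt_trans; apply.
  have -> : C * (M * (e / 2 / M / C)) = e / 2 by field; rewrite !gt_eqF.
  by lra.
exists (lim (x t @[t --> at_infty T])) => // xoo0.
have x_to0 e : 0 < e -> forall t, S t ->
    exists s, [/\ S s, t <= s & nrm (x s) <= e].
  move=> e0 t St; have [C' C'0 nC'] := vnorm_le_mx_norm nN.
  have e'0 : 0 < e / C' by rewrite divr_gt0.
  have /cvgrPdist_le/(_ _ e'0)/near_at_inftyP[B xB] := xcvg.
  have [s Ts] := unbounded_scale_gt (Num.max B t) Tub.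
  rewrite gt_max => /andP[Bs ts]; exists s; split; [|exact: ltW|].
    by apply: Sge St Ts _; exact: ltW.
  apply: le_trans (nC' _) _; rewrite mulrC -ler_pdivlMr//.
  by have := xB s Ts Bs; rewrite xoo0 sub0r normrN.
have xb0 := vanish_after nN Scl dx dFS K0S xK Sb
  (fun t St => Fb t St.1) x_to0.
have Sa : S a by split => //=; exact: lexx.
have := zero_tail_dichotomy nN Scl dx dFS K0S xK Sa
  (fun t St => St.2) Sb xb0.
case=> [x0S|[r [Sr xr Kr x0r]]].
  by left => t Tt at_; apply: x0S.
have [Tr ar] := Sr; right; exists r; split => //.
  by move: Kr; rewrite /mu sigma_tail.
by move=> t Tt rt; apply: x0r => //; exact: Sge Sr Tt (ltW rt).
Qed.
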